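(* Let $a,b$ be integers with $b\ge a\ge 1$, and let $G$ be a connected graph of order $n\ge 2(b+a+2)(b+2)$ with minimum degree $\delta(G)\ge a$. If $\lambda(G)\ge\lambda(F_n^{a,b})$, then $G$ has a fractional $[a,b]$-factor, unless $G\cong F_n^{a,b}$.
   Context: $\lambda(G)$ denotes the spectral radius (largest adjacency eigenvalue) of $G$. A fractional $[a,b]$-factor of $G$ exists if there is $h:E(G)\to[0,1]$ with $a\le\sum_{e\ni v}h(e)\le b$ for every vertex $v$. $K_m$ is the complete graph, $\cup$ disjoint union, $\vee$ join, $(b+1)K_1$ the edgeless graph on $b+1$ vertices. $F_n^{a,b}$ is the graph obtained from $K_{a}\vee\big(K_{n-(a+b+1)}\cup(b+1)K_1\big)$ by adding $a-1$ edges between one (fixed) vertex of $(b+1)K_1$ and $a-1$ vertices of $K_{n-(a+b+1)}$. *)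

(* Defs.v *)
From HB Require Import structures.
From mathcomp Require Import all_boot all_order all_algebra.
From mathcomp Require Import classical_sets reals.

Set Implicit Arguments.
Unset Strict Implicit.
Unset Printing Implicit Defensive.

Import Order.TTheory GRing.Theory Num.Theory.

Record sgraph := SGraph {
  vertex :> finType;
  adj : rel vertex;
  adj_sym : symmetric adj;
  adj_irr : irreflexive adj }.

Definition degree (G : sgraph) (v : G) : nat := #|[set u | adj v u]|.

(* A degree is always smaller than the order, so the neutral element #|G| never
   contributes when G has a vertex. *)
Definition min_degree (G : sgraph) : nat :=
  \big[minn/#|G|]_(v : G) degree v.

Definition connected_graph (G : sgraph) : Prop :=
  forall x y : G, connect (@adj G) x y.

Definition isomorphic (G H : sgraph) : Prop :=
  exists2 f : G -> H, bijective f & {mono f : x y / adj x y}.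

Definition edges (G : sgraph) : {set {set G}} :=
  [set [set p.1; p.2] | p in [pred p : G * G | adj p.1 p.2]].

(* Only the values of h on edges matter. *)
Definition fractional_factor (R : realType) (a b : nat) (G : sgraph) : Prop :=
  exists h : {set G} -> R,
    (forall e, e \in edges G -> (0 <= h e <= 1)%R) /\
    (forall v : G,
       (a%:R <= \sum_(e in edges G | v \in e) h e <= b%:R)%R).

Definition adjmx (R : realType) (G : sgraph) : 'M[R]_#|G| :=
  \matrix_(i, j) (adj (enum_val i) (enum_val j))%:R%R.

(* An adjacency matrix is real symmetric: if G has a vertex, its set of real
   eigenvalues is finite and nonempty, so that sup is a maximum. *)
Definition spectral_radius (R : realType) (G : sgraph) : R :=
  sup [set x : R | eigenvalue (adjmx R G) x]%classic.

Definition complete_rel (m : nat) : rel 'I_m := [rel x y | x != y].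

Fact complete_sym m : symmetric (@complete_rel m).
Proof. by move=> x y; rewrite /complete_rel /= eq_sym. Qed.

Fact complete_irr m : irreflexive (@complete_rel m).
Proof. by move=> x; rewrite /complete_rel /= eqxx. Qed.

Definition complete (m : nat) : sgraph :=
  SGraph (@complete_sym m) (@complete_irr m).

Definition edgeless_rel (m : nat) : rel 'I_m := [rel x y | false].

Fact edgeless_sym m : symmetric (@edgeless_rel m).
Proof. by []. Qed.

Fact edgeless_irr m : irreflexive (@edgeless_rel m).
Proof. by []. Qed.

Definition edgeless (m : nat) : sgraph :=
  SGraph (@edgeless_sym m) (@edgeless_irr m).

(* cross tells whether vertices of different summands are adjacent: false gives
   the disjoint union, true gives the join. *)
Definition sum_rel (cross : bool) (G H : sgraph) : rel (G + H) :=
  fun x y => match x, y with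
             | inl u, inl v => adj u v
             | inr u, inr v => adj u v
             | _, _ => cross
             end.

Fact sum_sym cross G H : symmetric (@sum_rel cross G H).
Proof. by move=> [x|x] [y|y] //=; apply: adj_sym. Qed.

Fact sum_irr cross G H : irreflexive (@sum_rel cross G H).
Proof. by move=> [x|x] /=; apply: adj_irr. Qed.

Definition disjoint_union (G H : sgraph) : sgraph :=
  SGraph (@sum_sym false G H) (@sum_irr false G H).

Definition join (G H : sgraph) : sgraph :=
  SGraph (@sum_sym true G H) (@sum_irr true G H).

Definition add_rel (G : sgraph) (r : rel G) : rel G :=
  [rel x y | adj x y || (x != y) && (r x y || r y x)].

Fact add_sym (G : sgraph) (r : rel G) : symmetric (add_rel r).
Proof. by move=> x y; rewrite /add_rel /= adj_sym eq_sym [r x y || _]orbC. Qed.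

Fact add_irr (G : sgraph) (r : rel G) : irreflexive (add_rel r).
Proof. by move=> x; rewrite /add_rel /= adj_irr eqxx. Qed.

Definition add_edges (G : sgraph) (r : rel G) : sgraph :=
  SGraph (@add_sym G r) (@add_irr G r).

Definition F_base (n a b : nat) : sgraph :=
  join (complete a)
       (disjoint_union (complete (n - (a + b + 1))) (edgeless b.+1)).

(* The distinguished vertex of (b+1)K_1 is the one of index 0, and it is joined
   to the vertices of K_(n-(a+b+1)) of index less than a - 1. *)
Definition F_extra (n a b : nat) : rel (F_base n a b) :=
  fun x y => match x, y with
             | inr (inr t), inr (inl k) => (t == ord0) && (k < a - 1)
             | _, _ => false
             end.

Definition F_graph (n a b : nat) : sgraph := add_edges (@F_extra n a b).

(* Main.v *)
Require Import Defs.
From HB Require Import structures.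
From mathcomp Require Import all_boot all_order all_algebra.
From mathcomp Require Import classical_sets reals.
From mathcomp Require Import functions boolp topology normedtype derive.
From mathcomp Require Import ring lra zify.

(* If G has no fractional [a,b]-factor, a least-squares optimum of the degree
   constraints yields disjoint S, T with b|S| + d_{G-S}(T) < a|T|, and the
   minimum degree forces t = |T| >= b+1.  For t >= b+2 the graph has so few edges
   that lambda(G)^2 <= 2 e(G) < (n-b-2)^2, while F contains K_{n-b-1}.  For
   t = b+1, the degrees in T are at least a and their total excess over a is at
   most a-1.  If one vertex carries the whole excess, then G is a spanning
   subgraph of F and Perron-Frobenius decides.  Otherwise complete the clique
   outside T: the Perron vector is nearly constant there, so that, after
   eliminating the coordinates in T, the radius is governed by the sum of the
   squared degrees over T, which is larger for F. *)

Set Implicit Arguments.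
Unset Strict Implicit.
Unset Printing Implicit Defensive.

Import Order.TTheory GRing.Theory Num.Theory.
Import numFieldNormedType.Exports.

(** * Minimisation of quadratic forms over compact sets *)

Section QuadraticForms.
Local Open Scope ring_scope.
Context (R : realType) (I : finType) (q : I -> I -> R).
Hypothesis q_sym : forall i j, q i j = q j i.

(** For symmetric [q] this is half the gradient of [qform]. *)
Definition qgrad (x : I -> R) i := \sum_j q i j * x j.
Definition qform (x : I -> R) := \sum_i x i * qgrad x i.

Lemma qgrad_perturb x i e k :
  qgrad (fun j => x j + e *+ (j == i)) k = qgrad x k + e * q k i.
Proof.
rewrite /qgrad (eq_bigr (fun j => q k j * x j + (if j == i then e * q k j else 0))).
  by rewrite big_split /= -big_mkcond big_pred1_eq.
by move=> j _; case: eqP => _; rewrite /= ?mulr1n ?mulr0n; ring.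
Qed.

Lemma qform_perturb x i e :
  qform (fun j => x j + e *+ (j == i)) =
  qform x + e * qgrad x i *+ 2 + e ^+ 2 * q i i.
Proof.
rewrite /qform (eq_bigr (fun k => x k * qgrad x k + e * (q i k * x k)
   + (if k == i then e * (qgrad x k + e * q k i) else 0))).
  rewrite !big_split /= -big_mkcond big_pred1_eq -mulr_sumr -/(qgrad x i); ring.
move=> k _; rewrite qgrad_perturb (q_sym i).
by case: eqP => _; rewrite /= ?mulr1n ?mulr0n; ring.
Qed.

Lemma continuous_sum (T : topologicalType) (J : finType) (f : J -> T -> R) :
  (forall j, continuous (f j)) -> continuous (fun t => \sum_j f j t).
Proof.
move=> cf; elim: (index_enum J) => [|j r IH] t.
  rewrite (_ : (fun _ => _) = cst 0); last by apply/funext => s; rewrite big_nil.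
  exact: cst_continuous.
rewrite (_ : (fun _ => _) = f j \+ (fun s => \sum_(k <- r) f k s)).
  by apply: continuousD; [exact: cf|exact: IH].
by apply/funext => s; rewrite big_cons.
Qed.

Let fun_of_row (v : 'rV[R]_#|I|) i := v ord0 (enum_rank i).
Let row_of_fun (x : I -> R) : 'rV[R]_#|I| := \row_k x (enum_val k).

Lemma row_of_funK x : fun_of_row (row_of_fun x) = x.
Proof. by apply/funext => i; rewrite /fun_of_row mxE enum_rankK. Qed.

Lemma qform_continuous : continuous (qform \o fun_of_row).
Proof.
apply: continuous_sum => i v; apply: continuousM; first exact: coord_continuous.
apply: continuous_sum => j {}v.
apply: continuousM; last exact: coord_continuous.
exact: cst_continuous.
Qed.

(** A box cut by a closed level set is compact. The constraint [f x = c] is trivial for minimisation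
    over a box and is the unit sphere for Rayleigh quotients. *)
Lemma qform_attains_min (lo up : I -> R) (f : (I -> R) -> R) c :
  continuous (f \o fun_of_row) ->
  (exists x, (forall i, lo i <= x i <= up i) /\ f x = c) ->
  exists x, [/\ forall i, lo i <= x i <= up i, f x = c &
    forall y, (forall i, lo i <= y i <= up i) -> f y = c -> qform x <= qform y].
Proof.
move=> cf [x0 [x0box fx0]].
pose box := [set v : 'rV[R]_#|I| | forall k, `[lo (enum_val k), up (enum_val k)]%classic (v ord0 k)]%classic.
pose A := (box `&` (f \o fun_of_row) @^-1` [set c])%classic.
have inA y : (forall i, lo i <= y i <= up i) -> f y = c -> row_of_fun y \in A.
  move=> ybox fy; apply/mem_set; split => /=.
    by move=> k /=; rewrite mxE in_itv /=; exact: ybox.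
  by rewrite row_of_funK.
have cA : compact A.
  apply: compact_closedI.
    by apply: (@rV_compact _ _ (fun k => `[lo (enum_val k), up (enum_val k)]%classic)) => k; exact: segment_compact.
  apply: preimage_closed; last exact: closed_eq.
  by move=> v _; exact: cf.
have [||v vA vmin] := @EVT_min_rV R _ (qform \o fun_of_row) A _ cA.
- by exists (row_of_fun x0); apply/set_mem/inA.
- by apply: continuous_subspaceT; exact: qform_continuous.
have [vbox fv] := set_mem vA.
exists (fun_of_row v); split=> //.
  move=> i; have := vbox (enum_rank i).
  by rewrite /= in_itv /= enum_rankK.
by move=> y ybox fy; have := vmin _ (inA _ ybox fy); rewrite /= row_of_funK.
Qed.

Lemma qgrad_ge0 x i s r : s ^+ 2 = 1 -> 0 < r ->
  (forall e, 0 < e <= r -> qform x <= qform (fun j => x j + (s * e) *+ (j == i))) ->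
  0 <= s * qgrad x i.
Proof.
move=> s2 r0 xmin; rewrite leNgt; apply/negP => gi.
(* [Q] exceeds [q i i] and [e * Q] is at most [- (s * qgrad x i)], so the quadratic term uses up at
   most half of the linear gain. *)
pose Q := `|q i i| + 1; pose e := Num.min r (- (s * qgrad x i) / Q).
have Q0 : 0 < Q by rewrite ltr_wpDl.
have e0 : 0 < e by rewrite lt_min r0 /= divr_gt0 ?oppr_gt0.
have eQ : e * Q <= - (s * qgrad x i) by rewrite -ler_pdivlMr // ge_min lexx orbT.
have qQ : q i i < Q by rewrite /Q (le_lt_trans (ler_norm _)) // ltrDl.
have : qform x <= qform (fun j => x j + (s * e) *+ (j == i)).
  by apply: xmin; rewrite e0 ge_min lexx.
rewrite qform_perturb -addrA lerDl; apply/negP; rewrite -ltNge.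
have : (s * e) ^+ 2 * q i i <= e * (e * Q).
  by rewrite exprMn s2 mul1r expr2 -mulrA ler_pM2l // ler_pM2l // ltW.
have : e * (e * Q) <= e * - (s * qgrad x i) by rewrite ler_pM2l.
have : 0 < e * - (s * qgrad x i) by rewrite mulr_gt0 // oppr_gt0.
rewrite mulr2n (_ : s * e * qgrad x i = - (e * - (s * qgrad x i))); last by ring.
lra.
Qed.

(** Complementary slackness at a minimum over the box: a coordinate not at the stated bound could
    still move against its gradient and lower the form. *)
Lemma qform_box_critical (lo up : I -> R) : (forall i, lo i <= up i) ->
  exists x, [/\ forall i, lo i <= x i <= up i,
    forall i, qgrad x i < 0 -> x i = up i & forall i, 0 < qgrad x i -> x i = lo i].
Proof.
move=> leq_lo_up.
have [||x [xbox _ xmin]] := @qform_attains_min lo up (fun=> 0) 0.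
- by move=> v; exact: cst_continuous.
- by exists lo; split=> // i; rewrite lexx leq_lo_up.
have step i s e : lo i <= x i + s * e <= up i ->
    qform x <= qform (fun j => x j + (s * e) *+ (j == i)).
  move=> box; apply: xmin => // j.
  by case: eqP => [->|_]; rewrite ?mulr1n // mulr0n addr0.
exists x; split=> // i gi; apply/eqP; rewrite eq_le;
  have /andP[xlo xup] := xbox i; rewrite ?xlo ?xup ?andbT /= leNgt; apply/negP => lt_x.
- suff : 0 <= 1 * qgrad x i by lra.
  apply: (@qgrad_ge0 _ _ _ (up i - x i)); [by rewrite expr1n|lra|].
  by move=> e he; apply: step; lra.
- suff : 0 <= -1 * qgrad x i by lra.
  apply: (@qgrad_ge0 _ _ _ (x i - lo i)); [by rewrite sqrrN expr1n|lra|].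
  by move=> e he; apply: step; lra.
Qed.

(** A zero of a nonnegative form is a minimum; were a gradient coordinate nonzero, the step [e]
    against it would make the form negative. *)
Lemma psd_qform_kernel x :
  (forall y, 0 <= qform y) -> qform x = 0 -> forall i, qgrad x i = 0.
Proof.
move=> psd fx0 i; apply/eqP/negPn/negP => gi.
pose Q := `|q i i| + 1; pose e := - qgrad x i / Q.
have Q0 : 0 < Q by rewrite ltr_wpDl.
have := psd (fun j => x j + e *+ (j == i)).
rewrite qform_perturb fx0 add0r leNgt => /negP; apply.
have qQ : q i i < Q by rewrite /Q (le_lt_trans (ler_norm _)) // ltrDl.
have -> : qgrad x i = - (e * Q) by rewrite /e divfK ?opprK // lt0r_neq0.
have e2 : 0 < e ^+ 2 by rewrite exprn_even_gt0 // mulf_neq0 ?oppr_eq0 ?invr_eq0 // lt0r_neq0.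
have : e ^+ 2 * q i i < e ^+ 2 * Q by rewrite ltr_pM2l.
have : 0 < e ^+ 2 * Q by rewrite mulr_gt0.
by rewrite mulr2n; lra.
Qed.

End QuadraticForms.

(** * Rayleigh quotients of symmetric matrices *)

Section Rayleigh.
Local Open Scope ring_scope.
Context (R : realType) (I : finType) (q : I -> I -> R).
Hypothesis q_sym : forall i j, q i j = q j i.

Lemma qformN x : qform (fun i j => - q i j) x = - qform q x.
Proof.
rewrite /qform -sumrN; apply: eq_bigr => i _; rewrite -mulrN /qgrad -sumrN.
by congr (_ * _); apply: eq_bigr => j _; rewrite mulNr.
Qed.

Lemma qformZ c x : qform q (fun i => c * x i) = c ^+ 2 * qform q x.
Proof.
rewrite /qform mulr_sumr; apply: eq_bigr => i _; rewrite /qgrad !mulr_sumr.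
by apply: eq_bigr => j _; ring.
Qed.

Lemma qgrad_shift mu x i :
  qgrad (fun i j => mu *+ (i == j) - q i j) x i = mu * x i - qgrad q x i.
Proof.
rewrite /qgrad (eq_bigr (fun j => (if j == i then mu * x i else 0) - q i j * x j)).
  by rewrite sumrB -big_mkcond big_pred1_eq.
by move=> j _; rewrite eq_sym; case: eqP => [->|_]; rewrite ?mulr1n ?mulr0n; ring.
Qed.

Lemma qform_shift mu x :
  qform (fun i j => mu *+ (i == j) - q i j) x = mu * \sum_i x i ^+ 2 - qform q x.
Proof.
rewrite /qform mulr_sumr -sumrB; apply: eq_bigr => i _.
by rewrite qgrad_shift; ring.
Qed.

Lemma sqr_sum_gt0 (x : I -> R) i : x i != 0 -> 0 < \sum_j x j ^+ 2.
Proof.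
move=> xi; rewrite (bigD1 i) //= ltr_pwDl ?sumr_ge0 // => [|j _]; last exact: sqr_ge0.
by rewrite exprn_even_gt0.
Qed.

Lemma qform_rayleigh (i0 : I) : exists mu,
  [/\ forall y, qform q y <= mu * \sum_i y i ^+ 2,
      exists2 x, qform q x = mu * \sum_i x i ^+ 2 & exists i, x i != 0 &
      forall y, qform q y = mu * \sum_i y i ^+ 2 -> forall i, qgrad q y i = mu * y i].
Proof.
(* The box from -1 to 1 contains the unit sphere and provides compactness. *)
have [||x [_ x1 xmax]] := @qform_attains_min R I (fun i j => - q i j)
    (fun=> -1) (fun=> 1) (fun x => \sum_i x i ^+ 2) 1.
- apply: continuous_sum => i v /=.
  by apply: continuousM; exact: coord_continuous.
- exists (fun i => (i == i0)%:R); split.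
    by move=> i; case: (i == i0); rewrite /= ?mulr1n ?mulr0n; lra.
  rewrite (bigD1 i0) //= eqxx expr1n big1 ?addr0 // => i /negPf ->.
  by rewrite expr0n.
have ray y : qform q y <= qform q x * \sum_i y i ^+ 2.
  set N := \sum_i _.
  have N_ge0 : 0 <= N by apply: sumr_ge0 => i _; exact: sqr_ge0.
  have [N0|N0] := eqVneq N 0.
    rewrite N0 mulr0 /qform big1 // => i _.
    have -> : y i = 0 by apply/eqP/negPn/negP => /sqr_sum_gt0; rewrite -/N N0 ltxx.
    by rewrite mul0r.
  have N_gt0 : 0 < N by rewrite lt_def N0.
  have s_gt0 : 0 < Num.sqrt N by rewrite sqrtr_gt0.
  pose z i := (Num.sqrt N)^-1 * y i.
  have z1 : \sum_i z i ^+ 2 = 1.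
    rewrite (eq_bigr (fun i => N^-1 * y i ^+ 2)) -?mulr_sumr ?mulVf // => i _.
    by rewrite /z exprMn exprVn sqr_sqrtr.
  have : qform (fun i j => - q i j) x <= qform (fun i j => - q i j) z.
    apply: xmax => // i; rewrite -ler_norml -(@expr_le1 _ 2) // real_normK ?num_real // -z1.
    by rewrite (bigD1 i) //= lerDl sumr_ge0 // => j _; exact: sqr_ge0.
  by rewrite !qformN lerN2 qformZ exprVn sqr_sqrtr // mulrC ler_pdivrMr.
exists (qform q x); split=> //.
  exists x; first by rewrite x1 mulr1.
  have [i /= xi|x0] := pickP (fun i => x i != 0); first by exists i.
  move: x1; rewrite big1 => [/eqP|i _]; first by rewrite eq_sym oner_eq0.
  by have /negbFE/eqP -> := x0 i; rewrite expr0n.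
move=> y fy i; apply/eqP; rewrite eq_sym -subr_eq0 -qgrad_shift; apply/eqP.
apply: psd_qform_kernel.
- by move=> j k; rewrite eq_sym q_sym.
- by move=> z; rewrite qform_shift subr_ge0.
- by rewrite qform_shift fy subrr.
Qed.

End Rayleigh.

(** * The spectral radius as maximal Rayleigh quotient *)

Section SpectralRadius.
Local Open Scope ring_scope.
Context (R : realType).
Implicit Type G : sgraph.

Definition adjR G (u v : G) : R := (adj u v)%:R.

Lemma adjR_sym G (u v : G) : adjR u v = adjR v u.
Proof. by rewrite /adjR adj_sym. Qed.

Lemma eigenvalue_adjmxP G (mu : R) :
  reflect (exists2 y : G -> R, exists u, y u != 0 & forall u, qgrad (@adjR G) y u = mu * y u)
    (eigenvalue (adjmx R G) mu).
Proof.
apply: (iffP eigenvalueP) => [[v vA v0]|[y [u yu] gy]].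
- exists (fun u => v ord0 (enum_rank u)).
    have /rV0Pn[i vi] := v0.
    by exists (enum_val i); rewrite enum_valK.
  move=> u; have /rowP/(_ (enum_rank u)) := vA; rewrite !mxE => <-.
  rewrite /qgrad (reindex (@enum_rank G)) /=; last exact/onW_bij/enum_rank_bij.
  by apply: eq_bigr => w _; rewrite !mxE !enum_rankK adjR_sym mulrC.
- exists (\row_i y (enum_val i)).
    apply/rowP => i; rewrite !mxE -gy /qgrad.
    rewrite (reindex (@enum_rank G)) /=; last exact/onW_bij/enum_rank_bij.
    by apply: eq_bigr => w _; rewrite !mxE !enum_rankK adjR_sym mulrC.
  by apply/rV0Pn; exists (enum_rank u); rewrite mxE enum_rankK.
Qed.

(** The Rayleigh maximum is itself an eigenvalue and bounds all eigenvalues, so it is the supremum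
    defining [spectral_radius]. *)
Lemma spectral_radiusP G (v0 : G) (lam := spectral_radius R G) :
  [/\ forall y, qform (@adjR G) y <= lam * \sum_u y u ^+ 2,
      exists2 x, qform (@adjR G) x = lam * \sum_u x u ^+ 2 & exists u, x u != 0 &
      forall y, qform (@adjR G) y = lam * \sum_u y u ^+ 2 ->
        forall u, qgrad (@adjR G) y u = lam * y u].
Proof.
have [mu [ray [x fx [u xu]] eig]] := qform_rayleigh (@adjR_sym G) v0.
suff -> : lam = mu by split=> //; exists x => //; exists u.
have mu_eig : eigenvalue (adjmx R G) mu.
  by apply/eigenvalue_adjmxP; exists x; [exists u|exact: eig].
have mu_ub : ubound [set t : R | eigenvalue (adjmx R G) t]%classic mu.
  move=> t /= /eigenvalue_adjmxP[y [w yw] gy].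
  have := ray y; rewrite /qform (eq_bigr (fun i => t * y i ^+ 2)).
    by rewrite -mulr_sumr ler_pM2r // (sqr_sum_gt0 yw).
  by move=> i _; rewrite gy; ring.
apply/eqP; rewrite eq_le; apply/andP; split.
  by apply: ge_sup => //; exists mu.
by apply: ub_le_sup => //; exists mu.
Qed.

End SpectralRadius.

(** * Obstructions to fractional factors *)

Section FractionalFactor.
Local Open Scope ring_scope.
Context (R : realType) (G : sgraph).

Lemma adj_neq (u v : G) : adj u v -> u != v.
Proof. by apply: contraTneq => ->; rewrite adj_irr. Qed.

Lemma edgesP (e : {set G}) :
  reflect (exists u v, adj u v /\ e = [set u; v]) (e \in edges G).
Proof.
apply: (iffP imsetP) => [[[u v] uv ->]|[u [v [uv ->]]]]; first by exists u, v.
by exists (u, v).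
Qed.

Lemma sum_incident_edges (h : {set G} -> R) (v : G) :
  \sum_(e in edges G | v \in e) h e = \sum_(u | adj v u) h [set v; u].
Proof.
rewrite -(big_imset (I := G) (h := fun u => [set v; u]) h (A := [pred u | adj v u])) /=.
  apply: eq_bigl => e; apply/andP/imsetP => [[/edgesP[x [y [xy ->]]]]|[u uv ->]].
    rewrite !inE => /orP[] /eqP ->; first by exists y.
    by exists x; rewrite ?inE 1?adj_sym // finset.setUC.
  by rewrite set21; split=> //; apply/edgesP; exists v, u.
move=> u w; rewrite !inE => uv wv /setP/(_ u); rewrite !inE eqxx orbT.
by rewrite eq_sym (negPf (adj_neq uv)) => /esym/eqP.
Qed.

Lemma sum_edge (r : G -> R) (u v : G) : adj u v ->
  \sum_(w in [set u; v]) r w = r u + r v.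
Proof. by move=> /adj_neq uv; rewrite big_setU1 ?inE //= big_set1. Qed.

(** The unknowns are edge weights ([inl e]) and target degrees ([inr u]); row [v] computes the
    weighted degree of [v] minus its target. *)
Let incidence (v : G) (i : {set G} + G) : R :=
  match i with
  | inl e => ((e \in edges G) && (v \in e))%:R
  | inr u => - (u == v)%:R
  end.

(** The quadratic form of [gram] is the sum of the squared defects. *)
Let gram i j := \sum_v incidence v i * incidence v j.

(* Least squares: with degrees allowed to slide in [a, b], minimise the squared
   defect.  The sign of the defect r at an optimum splits off S and T, and
   optimality forces weight 1 on edges from T to the complement of S and weight
   0 on edges from S to the complement of T. *)
Lemma fractional_factor_obstruction (a b : nat) : (a <= b)%N ->
  ~ fractional_factor R a b G ->
  exists S T : {set G}, [disjoint S & T] /\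
    (b * #|S| + \sum_(v in T) #|[set u | adj v u & u \notin S]| < a * #|T|)%N.
Proof.
move=> leab nofactor.
pose lo (i : {set G} + G) : R := if i is inl _ then 0 else a%:R.
pose up (i : {set G} + G) : R := if i is inl _ then 1 else b%:R.
have [||x [xbox xup xlo]] := @qform_box_critical R _ gram _ lo up.
- by move=> i j; apply: eq_bigr => v _; rewrite mulrC.
- by case=> [e|v] /=; rewrite ?ler01 ?ler_nat.
pose deg v := \sum_(u | adj v u) x (inl [set v; u]).
pose r v := deg v - x (inr v).
have gradE i : qgrad gram x i = \sum_v incidence v i * r v.
  transitivity (\sum_v incidence v i * \sum_j incidence v j * x j).
    rewrite /qgrad; under eq_bigr do rewrite /gram mulr_suml.
    rewrite exchange_big; apply: eq_bigr => v _; rewrite mulr_sumr.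
    by apply: eq_bigr => j _; rewrite mulrA.
  apply: eq_bigr => v _; congr (_ * _); rewrite big_sumType /= /r /deg.
  rewrite -(sum_incident_edges (x \o inl)) /=; congr (_ + _).
    rewrite [RHS]big_mkcond; apply: eq_bigr => e _.
    by case: ifP => _; rewrite ?mul1r ?mul0r.
  rewrite (bigD1 v) //= eqxx big1 ?addr0 ?mulN1r // => u /negPf ->.
  by rewrite oppr0 mul0r.
have grad_inr v : qgrad gram x (inr v) = - r v.
  rewrite gradE (bigD1 v) //= eqxx big1 ?addr0 ?mulN1r // => u.
  by rewrite eq_sym => /negPf ->; rewrite oppr0 mul0r.
have grad_inl u v : adj u v -> qgrad gram x (inl [set u; v]) = r u + r v.
  move=> uv; rewrite gradE -sum_edge // [RHS]big_mkcond; apply: eq_bigr => w _ /=.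
  have -> : [set u; v] \in edges G by apply/edgesP; exists u, v.
  by case: ifP => _; rewrite ?mul1r ?mul0r.
pose S := [set v | 0 < r v]; pose T := [set v | r v < 0].
exists S, T; split.
  by apply/pred0P => v; rewrite /= !inE; apply/negP; lra.
(* If all defects vanished, every degree would equal its target, which lies between [a] and [b], and
   the edge weights would form a factor. *)
have [w rw] : exists w, r w != 0.
  apply/not_existsP => r0; apply: nofactor; exists (x \o inl); split.
    by move=> e _; exact: (xbox (inl e)).
  move=> v; rewrite (sum_incident_edges (x \o inl)) -[X in _ <= X <= _]/(deg v).
  have /eqP : r v = 0 by apply/eqP/negPn/negP/r0.
  by rewrite subr_eq0 => /eqP ->; exact: (xbox (inr v)).
(* A negative defect is a positive gradient for the target, which therefore sits at its lower bound
   [a]; on [S] it sits at [b]. *)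
have degT v : v \in T -> deg v = a%:R + r v.
  by rewrite inE -oppr_gt0 -grad_inr => /xlo /= <-; rewrite /r; lra.
have degS v : v \in S -> deg v = b%:R + r v.
  by rewrite inE -oppr_lt0 -grad_inr => /xup /= <-; rewrite /r; lra.
(* The degree sums over [T] and over [S] both contain this weight between the two sets, which
   cancels when they are compared. *)
pose cross := \sum_(v in T) \sum_(u | adj v u && (u \in S)) x (inl [set v; u]).
have sumT : \sum_(v in T) deg v =
    cross + (\sum_(v in T) #|[set u | adj v u & u \notin S]|)%:R.
  rewrite natr_sum -big_split /=; apply: eq_bigr => v; rewrite inE => rv.
  rewrite /deg (bigID (mem S)) /=; congr (_ + _).
  rewrite -sum1_card natr_sum; apply: eq_big => [u|u /andP[vu uS]]; first by rewrite inE.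
  by rewrite xup // grad_inl //; move: uS; rewrite inE; lra.
have sumS : \sum_(v in S) deg v = cross.
  transitivity (\sum_(v in S) \sum_(u | adj v u && (u \in T)) x (inl [set v; u])).
    apply: eq_bigr => v; rewrite inE => rv.
    rewrite /deg (bigID (mem T)) /= [X in _ + X]big1 ?addr0 // => u /andP[vu uT].
    by rewrite xlo // grad_inl //; move: uT; rewrite inE; lra.
  rewrite /cross [RHS](exchange_big_dep (mem S)) /=; last by move=> v u vT /andP[].
  apply: eq_bigr => v vS; apply: eq_big => [u|u _]; first by rewrite adj_sym vS andbT andbC.
  by rewrite finset.setUC.
rewrite -(ltr_nat R) natrD !natrM.
have aT : a%:R * #|T|%:R = \sum_(v in T) (a%:R : R).
  by rewrite sumr_const mulr_natr.
have bS : b%:R * #|S|%:R = \sum_(v in S) (b%:R : R).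
  by rewrite sumr_const mulr_natr.
have rS : 0 <= \sum_(v in S) r v by apply: sumr_ge0 => v; rewrite inE => /ltW.
have rT : \sum_(v in T) r v <= 0 by apply: sumr_le0 => v; rewrite inE => /ltW.
have rST : \sum_(v in T) r v < \sum_(v in S) r v.
  have [w0|w0|/eqP] := ltgtP (r w) 0; last by rewrite (negPf rw).
    apply: lt_le_trans rS; rewrite (bigD1 w) ?inE //= -[ltRHS]addr0 ltr_leD //.
    by apply: sumr_le0 => v; rewrite inE => /andP[/ltW].
  apply: (le_lt_trans rT); rewrite (bigD1 w) ?inE //= -[ltLHS]addr0 ltr_leD //.
  by apply: sumr_ge0 => v; rewrite inE => /andP[/ltW].
rewrite (eq_bigr _ degT) big_split /= -aT in sumT.
rewrite (eq_bigr _ degS) big_split /= -bS in sumS.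
lra.
Qed.

End FractionalFactor.

(** * Perron vectors and monotonicity of the spectral radius *)

Section Perron.
Local Open Scope ring_scope.
Context (R : realType).
Implicit Types G H : sgraph.

Lemma adjR_ge0 G (u v : G) : 0 <= adjR R u v.
Proof. by rewrite /adjR ler0n. Qed.

Lemma qgrad_adjR G (x : G -> R) u : qgrad (@adjR R G) x u = \sum_(v | adj u v) x v.
Proof.
rewrite /qgrad [RHS]big_mkcond; apply: eq_bigr => v _.
by rewrite /adjR; case: (adj u v); rewrite ?mul1r ?mul0r.
Qed.

(** Taking absolute values of a maximiser does not lower the Rayleigh quotient, adjacency entries
    being nonnegative, so the result is again an eigenvector. *)
Lemma spectral_radius_eigenvector G (v0 : G) : exists x : G -> R,
  [/\ forall u, 0 <= x u, exists u, 0 < x u &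
      forall u, \sum_(v | adj u v) x v = spectral_radius R G * x u].
Proof.
have [ray [x fx [w xw]] eig] := spectral_radiusP R v0.
exists (fun u => `|x u|); split=> //; first by exists w; rewrite normr_gt0.
move=> u; rewrite -qgrad_adjR; apply: eig; apply/eqP; rewrite eq_le ray /=.
have -> : \sum_u0 `|x u0| ^+ 2 = \sum_u0 x u0 ^+ 2.
  by apply: eq_bigr => v _; rewrite real_normK ?num_real.
rewrite -fx; apply: ler_sum => v _; rewrite /qgrad !mulr_sumr.
apply: ler_sum => z _; rewrite mulrCA [leRHS]mulrCA.
by rewrite ler_wpM2l ?adjR_ge0 // -normrM ler_norm.
Qed.

Lemma spectral_radius_void G : #|G| = 0%N -> spectral_radius R G = 0.
Proof.
(* There is no eigenvalue, and [sup] of the empty set is 0 by default. *)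
move=> G0; rewrite /spectral_radius (_ : [set _ | _]%classic = set0) ?sup0 //.
apply/seteqP; split=> // t /eigenvalue_adjmxP[y [u]].
by have := card0_eq G0 u.
Qed.

Lemma spectral_radius_ge0 G : 0 <= spectral_radius R G.
Proof.
have [v0 _|G0] := pickP (@predT G); last first.
  by rewrite spectral_radius_void //; exact: eq_card0.
have [x [x_ge0 [u xu] eig]] := spectral_radius_eigenvector v0.
by rewrite -(pmulr_lge0 _ xu) -eig sumr_ge0.
Qed.

(** The Rayleigh bound of [H] pulled back along [f], so that a vector living on the vertices of
    another graph can be tested in [H]. *)
Lemma qform_reindex (V : finType) H (f : V -> H) (x : V -> R) : bijective f ->
  \sum_u x u * (\sum_(v | adj (f u) (f v)) x v) <=
    spectral_radius R H * \sum_u x u ^+ 2.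
Proof.
move=> f_bij; have [g gK fK] := f_bij.
have [v0 _|V0] := pickP (@predT V); last first.
  by rewrite big_pred0 // [X in _ * X]big_pred0 // mulr0.
have [ray _ _] := spectral_radiusP R (f v0).
have := ray (x \o g); rewrite [X in _ * X](reindex f) /=; last exact/onW_bij.
rewrite (eq_bigr (fun u => x u ^+ 2)) => [|u _]; last by rewrite gK.
apply: le_trans; rewrite /qform (reindex f) /=; last exact/onW_bij.
apply: ler_sum => u _; rewrite gK qgrad_adjR [X in _ <= _ * X](reindex f) /=; last exact/onW_bij.
by rewrite [X in _ <= _ * X](eq_bigr x) // => v _; rewrite gK.
Qed.

(** The Perron vector of [G] is a test vector for [H], where its neighbour sums can only grow. *)
Lemma spectral_radius_hom G H (f : G -> H) : bijective f ->
  {homo f : u v / adj u v} -> spectral_radius R G <= spectral_radius R H.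
Proof.
move=> f_bij hom.
have [v0 _|G0] := pickP (@predT G); last first.
  by rewrite spectral_radius_void ?spectral_radius_ge0 //; exact: eq_card0.
have [x [x_ge0 [u xu] eig]] := spectral_radius_eigenvector v0.
have N0 : 0 < \sum_w x w ^+ 2 by rewrite (@sqr_sum_gt0 _ _ x u) // lt0r_neq0.
rewrite -(ler_pM2r N0); apply: le_trans (qform_reindex x f_bij).
rewrite mulr_sumr; apply: ler_sum => w _.
rewrite expr2 mulrA -eig mulrC ler_wpM2l // big_mkcond [leRHS]big_mkcond /=.
by apply: ler_sum => z _; have := @hom w z; case: (adj w z) => [->|_] //; case: ifP.
Qed.

(** A zero entry forces a zero neighbour sum, so the zero set is closed under adjacency and
    connectedness would make the vector vanish. *)
Lemma eigenvector_gt0 G (x : G -> R) lam : connected_graph G ->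
  (forall u, 0 <= x u) -> (exists u, 0 < x u) ->
  (forall u, \sum_(v | adj u v) x v = lam * x u) -> forall u, 0 < x u.
Proof.
move=> conn x_ge0 [w xw] eig u; rewrite lt_def x_ge0 andbT; apply/negP => xu.
have step v z : adj v z -> x v = 0 -> x z = 0.
  move=> vz xv; have := eig v; rewrite xv mulr0.
  by move/psumr_eq0P => -> // t _.
have cl : fingraph.closed (@adj G) [pred v | x v == 0].
  move=> v z vz; apply/idP/idP; rewrite !inE => /eqP h; apply/eqP.
    exact: step vz h.
  by apply: step h; rewrite adj_sym.
have := closed_connect cl (conn u w); rewrite !inE xu => /esym/eqP xw0.
by rewrite xw0 ltxx in xw.
Qed.

(** An additional edge in [H] would strictly raise the Rayleigh quotient of the Perron vector of
    [G], which is positive everywhere. *)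
Lemma spectral_radius_strict G H (f : G -> H) : bijective f ->
  {homo f : u v / adj u v} -> connected_graph G ->
  spectral_radius R H <= spectral_radius R G -> isomorphic G H.
Proof.
move=> f_bij hom conn leHG; exists f => // u v.
apply/idP/idP => [fuv|]; last exact: hom.
apply/negPn/negP => nuv.
have [x [x_ge0 x_pos eig]] := spectral_radius_eigenvector u.
have x_gt0 := eigenvector_gt0 conn x_ge0 x_pos eig.
have le_sum w : \sum_(z | adj w z) x z <= \sum_(z | adj (f w) (f z)) x z.
  rewrite big_mkcond [leRHS]big_mkcond /=.
  by apply: ler_sum => z _; have := @hom w z; case: (adj w z) => [->|_] //; case: ifP.
have lt_sum : \sum_(z | adj u z) x z < \sum_(z | adj (f u) (f z)) x z.
  rewrite [ltRHS](bigD1 v) //= -[ltLHS]add0r ltr_leD //.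
  rewrite big_mkcond [leRHS]big_mkcond /=; apply: ler_sum => z _.
  have := @hom u z; have [->|_] := eqVneq z v; first by rewrite (negPf nuv) andbF.
  by case: (adj u z) => [->|_] //; case: ifP.
have := qform_reindex x f_bij; rewrite leNgt => /negP; apply.
apply: (@le_lt_trans _ _ (\sum_w x w * \sum_(z | adj w z) x z)).
  rewrite [leRHS](eq_bigr (fun w => spectral_radius R G * x w ^+ 2)) => [|w _].
    by rewrite -mulr_sumr ler_wpM2r // sumr_ge0 // => w _; exact: sqr_ge0.
  by rewrite eig; ring.
rewrite [ltLHS](bigD1 u) //= [ltRHS](bigD1 u) //= ltr_leD // ?ltr_pM2l //.
by apply: ler_sum => w _; rewrite ler_pM2l.
Qed.

(** Cauchy-Schwarz against the constant vector, by expanding the sum of the squares of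
    [k * x i - s]. *)
Lemma sqr_sum_le (I : finType) (A : pred I) (x : I -> R) :
  (\sum_(i | A i) x i) ^+ 2 <= #|A|%:R * \sum_(i | A i) x i ^+ 2.
Proof.
set s := \sum_(i | A i) x i; set k : R := #|A|%:R.
have [k0|k0] := eqVneq k 0.
  rewrite /s big_pred0 ?expr0n /= ?k0 ?mul0r // => i.
  by move/eqP: k0; rewrite /k pnatr_eq0 => /eqP/card0_eq/(_ i).
have k_gt0 : 0 < k by rewrite lt_def k0 ler0n.
have : 0 <= \sum_(i | A i) (k * x i - s) ^+ 2 by apply: sumr_ge0 => i _; exact: sqr_ge0.
rewrite (eq_bigr (fun i => k ^+ 2 * x i ^+ 2 + (- (2 * k * s)) * x i + s ^+ 2)); last first.
  by move=> i _; ring.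
rewrite !big_split /= -!mulr_sumr sumr_const -/s -[_ *+ #|A|]mulr_natr -/k.
set q := \sum_(i | A i) _ => h.
rewrite -subr_ge0 -(pmulr_rge0 _ k_gt0); lra.
Qed.

(** Cauchy-Schwarz bounds the square of each eigenvalue equation by the degree times the squared
    norm; summation gives twice the number of edges. *)
Lemma spectral_radius_sqr_le G : spectral_radius R G ^+ 2 <= (\sum_(u : G) degree u)%:R.
Proof.
have [v0 _|G0] := pickP (@predT G); last first.
  by rewrite spectral_radius_void ?expr0n ?ler0n //; exact: eq_card0.
have [x [x_ge0 [u xu] eig]] := spectral_radius_eigenvector v0.
have N0 : 0 < \sum_w x w ^+ 2 by rewrite (@sqr_sum_gt0 _ _ x u) // lt0r_neq0.
rewrite -(ler_pM2r N0) natr_sum mulr_sumr mulr_suml; apply: ler_sum => w _.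
rewrite -exprMn -eig; apply: le_trans (sqr_sum_le _ _) _.
rewrite (_ : #|adj w| = degree w); last by apply: eq_card => z; rewrite !inE.
rewrite ler_wpM2l ?ler0n // [leRHS](bigID (adj w)) /= lerDl.
by apply: sumr_ge0 => z _; exact: sqr_ge0.
Qed.

End Perron.

(** * Copies of the extremal graph on a given vertex set *)

Section ExtremalGraph.
Variables (V : finType) (S T E : {set V}) (t0 : V).

(* A copy of F_n^{a,b} on V: S plays K_a, T plays (b+1)K_1, and the vertex t0
   of T is moreover joined to the a - 1 vertices of E. *)
Definition extremal_half : rel V :=
  fun u v => (u \notin T) && (v \notin T) ||
             (u \in T) && ((v \in S) || (u == t0) && (v \in E)).

Definition extremal_rel : rel V :=
  fun u v => (u != v) && (extremal_half u v || extremal_half v u).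

Lemma extremal_rel_iso (n a b : nat) : #|V| = n -> 0 < a ->
  [disjoint S & T] -> [disjoint E & T] -> [disjoint S & E] -> t0 \in T ->
  #|S| = a -> #|T| = b.+1 -> #|E| = a.-1 ->
  exists2 f : V -> F_graph n a b, bijective f &
    forall u v, adj (f u) (f v) = extremal_rel u v.
Proof.
move=> cV a0 ST ET SE t0T cS cT cE.
pose C := ~: (S :|: E :|: T).
have cC : #|C| + #|E| = n - (a + b + 1).
  have := cardsC (S :|: E :|: T); rewrite -/C cV.
  have -> : #|S :|: E :|: T| = #|S| + #|E| + #|T|.
    rewrite !cardsU (disjoint_setI0 SE) cards0 subn0.
    by rewrite finset.setIUl (disjoint_setI0 ST) (disjoint_setI0 ET) finset.set0U cards0 subn0.
  lia.
(* Listing [E] first gives its vertices the indices below [a - 1], and listing [t0] first gives it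
   index 0, as [F_extra] requires. *)
pose sR := enum E ++ enum C; pose sT := t0 :: enum (T :\ t0).
have sizeR : size sR = n - (a + b + 1) by rewrite size_cat -!cardE addnC.
have sizeT : size sT = b.+1 by rewrite /= -cardE; have := cardsD1 t0 T; rewrite t0T cT; lia.
have inR k : k < n - (a + b + 1) -> nth t0 sR k \in E :|: C.
  by rewrite -sizeR => /(mem_nth t0); rewrite mem_cat !mem_enum !inE.
have inT k : k < b.+1 -> nth t0 sT k \in T.
  rewrite -sizeT => /(mem_nth t0); rewrite inE mem_enum inE.
  by case/predU1P => [->|/andP[]].
have inS k : k < a -> nth t0 (enum S) k \in S.
  by rewrite -cS cardE => /(mem_nth t0); rewrite mem_enum.
have uniqR : uniq sR.
  rewrite cat_uniq !enum_uniq andbT /=; apply/hasPn => x.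
  by rewrite !mem_enum !inE !negb_or => /andP[/andP[]].
have uniqT : uniq sT by rewrite /= enum_uniq mem_enum !inE eqxx.
pose g (p : F_graph n a b) : V :=
  match p with
  | inl i => nth t0 (enum S) i
  | inr (inl k) => nth t0 sR k
  | inr (inr t) => nth t0 sT t
  end.
have notST x : x \in S -> x \in T -> False by move=> xS; rewrite (disjointFr ST xS).
have notSE x : x \in S -> x \in E -> False by move=> xS; rewrite (disjointFr SE xS).
have notET x : x \in E -> x \in T -> False by move=> xE; rewrite (disjointFr ET xE).
have gS i : g (inl i) \in S by apply: inS; exact: ltn_ord.
have gT t : g (inr (inr t)) \in T by apply: inT; exact: ltn_ord.
have gR k : (g (inr (inl k)) \in S = false) * (g (inr (inl k)) \in T = false).
  have := inR k (ltn_ord k); rewrite -[nth _ _ _]/(g (inr (inl k))) !inE !negb_or.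
  case/orP => [xE|/andP[/andP[/negPf-> _] /negPf->]] //.
  by split; apply/negP => h; [exact: notSE h xE|exact: notET xE h].
have gE k : (g (inr (inl k)) \in E) = (k < a - 1).
  rewrite /g nth_cat -cardE cE subn1; case: ltnP => ka.
    by rewrite -mem_enum mem_nth // -cardE cE.
  have : nth t0 (enum C) (k - a.-1) \in enum C.
    by apply: mem_nth; rewrite -cardE; have := ltn_ord k; lia.
  by rewrite mem_enum !inE !negb_or => /andP[/andP[_ /negPf->]].
have gt0 t : (g (inr (inr t)) == t0) = (t == ord0).
  by rewrite -[X in _ == X]/(nth t0 sT 0) nth_uniq // sizeT ltn_ord.
have gST i : g (inl i) \in T = false by apply/negP => /(notST _ (gS i)).
have gSE i : g (inl i) \in E = false by apply/negP => /(notSE _ (gS i)).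
have gTS t : g (inr (inr t)) \in S = false by apply/negP => /notST/(_ (gT t)).
have gTE t : g (inr (inr t)) \in E = false by apply/negP => /notET/(_ (gT t)).
have g_inj : injective g.
  move=> [i|[k|t]] [i'|[k'|t']] e.
  - congr inl; apply/val_inj/eqP.
    by rewrite -(nth_uniq t0 _ _ (enum_uniq S)) -?cardE ?cS ?ltn_ord //; apply/eqP.
  - by have := gS i; rewrite e gR.
  - by have := gS i; rewrite e gTS.
  - by have := gS i'; rewrite -e gR.
  - congr (inr (inl _)); apply/val_inj/eqP.
    by rewrite -(nth_uniq t0 _ _ uniqR) ?sizeR ?ltn_ord //; apply/eqP.
  - by have := gT t'; rewrite -e gR.
  - by have := gS i'; rewrite -e gTS.
  - by have := gT t; rewrite e gR.
  - congr (inr (inr _)); apply/val_inj/eqP.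
    by rewrite -(nth_uniq t0 _ _ uniqT) ?sizeT ?ltn_ord //; apply/eqP.
have g_bij : bijective g.
  apply: inj_card_bij g_inj _; rewrite !card_sum !card_ord cV.
  have : #|E| + #|S| + #|T| <= n.
    rewrite -cV; have := max_card (mem (S :|: E :|: T)).
    rewrite !cardsU (disjoint_setI0 SE) cards0 subn0.
    by rewrite finset.setIUl (disjoint_setI0 ST) (disjoint_setI0 ET) finset.set0U cards0 subn0; lia.
  lia.
have g_adj p q : adj p q = extremal_rel (g p) (g q).
  rewrite /extremal_rel (inj_eq g_inj) /extremal_half.
  case: p => [i|[k|t]]; case: q => [i'|[k'|t']];
    rewrite ?gS ?gT ?gST ?gSE ?gTS ?gTE ?gR ?gE ?gt0 /= /add_rel /= ?andbF ?andbT ?orbF ?orbT //=.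
have [f fK gK] := g_bij; exists f; first by exists g.
by move=> u v; rewrite g_adj !gK.
Qed.

End ExtremalGraph.

(** * Perron vectors when the complement of [T] is a clique *)

Section Comparison.
Local Open Scope ring_scope.
Context (R : realType).

(** The indicator vector of [W] is the test vector. *)
Lemma clique_spectral_radius (H : sgraph) (W : {set H}) :
  {in W &, forall u v, u != v -> adj u v} -> (0 < #|W|)%N ->
  #|W|%:R - 1 <= spectral_radius R H.
Proof.
move=> clique W_gt0; have W0 : 0 < #|W|%:R :> R by rewrite ltr0n.
have := @qform_reindex R H H id (fun u => (u \in W)%:R) (Bijective (fun=> erefl) (fun=> erefl)).
have -> : \sum_u (u \in W)%:R ^+ 2 = #|W|%:R :> R.
  rewrite -sum1_card natr_sum [RHS]big_mkcond /=; apply: eq_bigr => u _.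
  by case: (u \in W); rewrite ?expr1n ?expr0n.
move=> ray; rewrite -(ler_pM2r W0); apply: le_trans ray.
rewrite mulrC mulr_natl -sumr_const big_mkcond /=; apply: ler_sum => u _.
case: ifP => uW; last by rewrite mul0r.
rewrite mul1r -sum1_card (bigD1 u) //= natrD addrAC subrr add0r natr_sum.
rewrite big_mkcond [leRHS]big_mkcond /=; apply: ler_sum => v _.
case: andP => [[vW uv]|_]; last by case: ifP; rewrite ?ler0n.
by rewrite clique // 1?eq_sym // vW.
Qed.

Section Clique.
Context (G : sgraph) (T : {set G}) (x : G -> R) (lam : R).
Hypothesis clique : forall u v, u \notin T -> v \notin T -> u != v -> adj u v.
Hypothesis x_ge0 : forall u, 0 <= x u.
Hypothesis lam_gt0 : 0 < lam.
Hypothesis eig : forall u, \sum_(v | adj u v) x v = lam * x u.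

Lemma neighbour_sum_le M u : (forall v, x v <= M) -> lam * x u <= (degree u)%:R * M.
Proof.
move=> xM; rewrite -eig /degree -sum1_card natr_sum mulr_suml.
rewrite (eq_bigl (mem [set v | adj u v])) => [|v]; last by rewrite !inE.
by apply: ler_sum => v _; rewrite mul1r.
Qed.

(** At a maximal entry [M], [(lam + 1) * M] is at most the sum of all entries; at [w] off [T], which
    sees the rest of the clique, [(lam + 1) * x w] is at least the sum off [T]. The difference is
    the mass on [T], bounded through the degrees. *)
Lemma clique_eigenvector_gap : (exists u, 0 < x u) ->
  (forall t, t \in T -> (degree t)%:R < lam) ->
  exists M, [/\ 0 < M, forall v, x v <= M & forall w, w \notin T ->
    lam * (lam + 1) * (M - x w) <= (\sum_(t in T) degree t)%:R * M].
Proof.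
move=> [u0 xu0] degT.
case: (@Order.TotalTheory.arg_maxP _ _ _ u0 predT x) => // u _ xmax.
have xM v : x v <= x u by exact: xmax.
have M0 : 0 < x u by exact: lt_le_trans (xM u0).
exists (x u); split=> // w wT.
have uT : u \notin T.
  apply/negP => /degT; rewrite -(ltr_pM2r M0) ltNge => /negP; apply.
  exact: neighbour_sum_le.
pose K := \sum_(v | v \notin T) x v.
have Kw : K <= (lam + 1) * x w.
  rewrite mulrDl mul1r -eig /K (bigD1 w) //= addrC lerD2r.
  rewrite big_mkcond [leRHS]big_mkcond /=; apply: ler_sum => v _.
  case: andP => [[vT vw]|_]; last by case: ifP.
  by rewrite clique // eq_sym.
have Ku : (lam + 1) * x u <= K + \sum_(t in T) x t.
  rewrite mulrDl mul1r -eig /K addrC.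
  have -> : \sum_(v | v \notin T) x v + \sum_(t in T) x t = \sum_v x v.
    by rewrite [RHS](bigID (mem T)) /= addrC.
  rewrite [leRHS](bigD1 u) //= lerD2l big_mkcond [leRHS]big_mkcond /=.
  apply: ler_sum => v _; case: ifP => [uv|_]; last by case: ifP.
  by have [vu|] := eqVneq v u; [rewrite vu adj_irr in uv|].
have xT : lam * \sum_(t in T) x t <= (\sum_(t in T) degree t)%:R * x u.
  rewrite natr_sum mulr_sumr mulr_suml; apply: ler_sum => t _.
  exact: neighbour_sum_le.
apply: le_trans xT; rewrite -mulrA ler_pM2l //; lra.
Qed.

(* Both sides compare the Rayleigh quotients of G and H after eliminating the
   coordinates in T: off T the two quadratic forms coincide. *)
Lemma clique_compare (H : sgraph) (f : G -> H) (e : rel G) :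
  bijective f -> (forall u v, adj (f u) (f v) = e u v) ->
  (forall u v, u \notin T -> v \notin T -> e u v = (u != v)) ->
  (forall u v, u \in T -> v \in T -> e u v = false) ->
  spectral_radius R H <= lam ->
  \sum_(t in T) (\sum_(v | (v \notin T) && e t v) x v) ^+ 2 <=
  \sum_(t in T) (lam * x t) ^+ 2.
Proof.
move=> f_bij ef e_clique e_indep leH.
have e_sym u v : e u v = e v u by rewrite -!ef adj_sym.
pose X t := \sum_(v | (v \notin T) && e t v) x v.
(* On [T] this test vector solves the eigenvalue equation of [H] for the value [lam], given the
   entries of [x] off [T]. *)
pose y u := if u \in T then X u / lam else x u.
pose Q := \sum_(u | u \notin T) x u * \sum_(v | (v \notin T) && (u != v)) x v.
have := @qform_reindex R G H f y f_bij.
have -> : \sum_u y u * (\sum_(v | adj (f u) (f v)) y v) =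
    Q + (lam * \sum_(t in T) (X t / lam) ^+ 2) *+ 2.
  rewrite (bigID (mem T)) /=.
  have -> : \sum_(u in T) y u * (\sum_(v | adj (f u) (f v)) y v) =
      lam * \sum_(t in T) (X t / lam) ^+ 2.
    rewrite mulr_sumr; apply: eq_bigr => t tT; rewrite {1}/y tT.
    have -> : \sum_(v | adj (f t) (f v)) y v = X t.
      apply: eq_big => [v|v]; rewrite ef.
        by case: (boolP (v \in T)) => // vT; rewrite e_indep.
      by move=> tv; rewrite /y ifN //; apply/negP => vT; rewrite e_indep in tv.
    by field; rewrite lt0r_neq0.
  have -> : \sum_(u | u \notin T) y u * (\sum_(v | adj (f u) (f v)) y v) =
      Q + lam * \sum_(t in T) (X t / lam) ^+ 2.
    transitivity (Q + \sum_(u | u \notin T) \sum_(t in T | e t u) x u * (X t / lam)).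
      rewrite -big_split /=; apply: eq_bigr => u uT.
      rewrite {1}/y (negPf uT) -mulr_sumr -mulrDr addrC (bigID (mem T)) /=.
      congr (_ * (_ + _)); apply: eq_big => [v|v].
      - by rewrite ef e_sym andbC.
      - by case/andP => _ vT; rewrite /y vT.
      - rewrite ef andbC; case: (boolP (v \in T)) => //= vT; exact: e_clique.
      - by case/andP => _ vT; rewrite /y (negPf vT).
    congr (_ + _); rewrite (exchange_big_dep (mem T)) /=; last by move=> u t _ /andP[].
    rewrite mulr_sumr; apply: eq_bigr => t tT; rewrite -mulr_suml.
    have -> : \sum_(i | [&& i \notin T, t \in T & e t i]) x i = X t.
      by apply: eq_bigl => v; rewrite tT.
    by field; rewrite lt0r_neq0.
  by rewrite mulr2n; ring.
have -> : \sum_u y u ^+ 2 = \sum_(t in T) (X t / lam) ^+ 2 + \sum_(u | u \notin T) x u ^+ 2.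
  rewrite (bigID (mem T)) /=; congr (_ + _); apply: eq_bigr => u uT; rewrite /y ?uT //.
  by rewrite (negPf uT).
(* The eigenvalue equations of [G] off [T], summed; only an inequality results, because edges inside
   [T] are dropped. *)
have Qx : lam * \sum_(u | u \notin T) x u ^+ 2 <= Q + lam * \sum_(t in T) x t ^+ 2.
  have -> : lam * \sum_(u | u \notin T) x u ^+ 2 =
      Q + \sum_(u | u \notin T) \sum_(t in T | adj t u) x u * x t.
    rewrite -big_split mulr_sumr /=; apply: eq_bigr => u uT.
    rewrite expr2 mulrA -eig mulrC -mulr_sumr -mulrDr addrC (bigID (mem T)) /=.
    congr (_ * (_ + _)); apply: eq_bigl => v; first by rewrite adj_sym andbC.
    rewrite andbC; case: (boolP (v \in T)) => //= vT.
    by have [<-|uv] := eqVneq u v; [rewrite adj_irr|rewrite clique].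
  rewrite lerD2l (exchange_big_dep (mem T)) /=; last by move=> u t _ /andP[].
  rewrite mulr_sumr; apply: ler_sum => t tT; rewrite -mulr_suml expr2 mulrA ler_wpM2r //.
  rewrite -eig big_mkcond [leRHS]big_mkcond /=; apply: ler_sum => u _.
  by rewrite tT /=; case: (adj t u); rewrite ?andbF //; case: ifP.
set Y := \sum_(t in T) (X t / lam) ^+ 2 => ray.
have Z0 : 0 <= Y + \sum_(u | u \notin T) x u ^+ 2.
  by apply: addr_ge0; apply: sumr_ge0 => u _; exact: sqr_ge0.
have := ler_wpM2r Z0 leH; move: ray Qx => ray Qx ray2.
(* [Q] and the squares off [T] cancel between the two bounds. *)
have YT : lam * Y <= lam * \sum_(t in T) x t ^+ 2 by rewrite mulr2n in ray; lra.
have lam2 : 0 <= lam by exact: ltW.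
have -> : \sum_(t in T) X t ^+ 2 = lam * (lam * Y).
  by rewrite /Y !mulr_sumr; apply: eq_bigr => t _; field; rewrite lt0r_neq0.
have -> : \sum_(t in T) (lam * x t) ^+ 2 = lam * (lam * \sum_(t in T) x t ^+ 2).
  by rewrite !mulr_sumr; apply: eq_bigr => t _; ring.
by rewrite ler_wpM2l.
Qed.

End Clique.
End Comparison.

(** * Degree and edge counts *)

Section Counting.
Variables (G : sgraph) (S T : {set G}).
Local Notation outdeg := (fun v => #|[set u | adj v u & u \notin S]|).

Lemma min_degree_le (v : G) : min_degree G <= degree v.
Proof.
rewrite /min_degree; have := mem_index_enum v; elim: (index_enum G) => //= u r IH.
rewrite inE big_cons geq_min => /predU1P[->|/IH ->]; first by rewrite leqnn.
by rewrite orbT.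
Qed.

Lemma degree_split v : degree v = #|[set u | adj v u & u \in S]| + outdeg v.
Proof.
rewrite /degree -(cardsID S [set u | adj v u]); congr (_ + _);
  by apply: eq_card => u; rewrite !inE // andbC.
Qed.

Lemma degree_le v : degree v <= #|S| + outdeg v.
Proof.
rewrite degree_split leq_add2r; apply: subset_leq_card; apply/fintype.subsetP => u.
by rewrite inE => /andP[].
Qed.

(** The first summand bounds the degrees inside the complement of [T]. The edges from there to [T]
    are counted again by the degrees in [T], hence the factor 2. *)
Lemma sum_degree_le :
  \sum_(v : G) degree v <=
    (#|G| - #|T|) * (#|G| - #|T|).-1 + 2 * \sum_(v in T) degree v.
Proof.
rewrite (bigID (mem T)) /= mul2n -addnn addnCA leq_add2l.
have -> : \sum_(v | v \notin T) degree v =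
    \sum_(v | v \notin T) #|[set u | adj v u & u \notin T]| +
    \sum_(v | v \notin T) #|[set u | adj v u & u \in T]|.
  rewrite -big_split /=; apply: eq_bigr => v _.
  rewrite /degree -(cardsID T [set u | adj v u]) addnC; congr (_ + _);
  by apply: eq_card => u; rewrite !inE // andbC.
apply: leq_add.
  have cC : #|~: T| = #|G| - #|T| by rewrite -(cardsC T) addKn.
  rewrite -cC -sum_nat_const (eq_bigl (mem (~: T))) => [|v]; last by rewrite !inE.
  apply: leq_sum => v; rewrite !inE => vT.
  rewrite -ltnS prednK; last by apply/card_gt0P; exists v; rewrite inE.
  rewrite (cardsD1 v (~: T)) inE vT ltnS; apply: subset_leq_card.
  apply/fintype.subsetP => u; rewrite !inE => /andP[vu ->]; rewrite andbT.
  by rewrite eq_sym (adj_neq vu).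
under eq_bigr do rewrite -sum1_card.
rewrite (exchange_big_dep (mem T)) /=; last by move=> v u _; rewrite inE => /andP[].
apply: leq_sum => u uT; rewrite sum1_card; apply: subset_leq_card.
by apply/fintype.subsetP => v; rewrite unfold_in /= !inE adj_sym => /and3P[].
Qed.

(** Each vertex of [T] has at least [a - #|S|] neighbours outside [S]. If [#|T| <= b], this
    contradicts the obstruction when [#|S| < a]; otherwise [b * #|S|] alone reaches [a * #|T|]. *)
Lemma obstruction_card (a b : nat) : 0 < a -> a <= b -> a <= min_degree G ->
  b * #|S| + \sum_(v in T) outdeg v < a * #|T| -> b < #|T|.
Proof.
move=> a0 ab amin obs; rewrite ltnNge; apply/negP => Tb.
have : (a - #|S|) * #|T| <= \sum_(v in T) outdeg v.
  rewrite mulnC -sum_nat_const; apply: leq_sum => v _.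
  rewrite leq_subLR; apply: leq_trans (degree_le v).
  by apply: leq_trans (min_degree_le v).
have [aS|Sa] := leqP a #|S|; first by nia.
by rewrite mulnBl; nia.
Qed.

End Counting.

(** * Subsets of prescribed size and numerical inequalities *)

Lemma subset_of_card (V : finType) (A : {set V}) k : k <= #|A| ->
  exists2 B : {set V}, B \subset A & #|B| = k.
Proof.
move=> kA; exists [set x in take k (enum A)].
  by apply/fintype.subsetP => x; rewrite inE => /mem_take; rewrite mem_enum.
rewrite cardsE (card_uniqP _) ?take_uniq ?enum_uniq // size_take -cardE.
by case: ltngtP kA.
Qed.

(** Here [s] and [t] stand for the sizes of [S] and [T], and [d] for the number of neighbours
    outside [S] summed over [T]; the left side then bounds twice the number of edges. *)
Lemma edge_count_bound (a b n s t d : nat) : 0 < a -> a <= b ->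
  2 * (b + a + 2) * (b + 2) <= n -> b + 2 <= t -> s + t <= n ->
  b * s + d < a * t ->
  (n - t) * (n - t).-1 + 2 * (s * t + d) < (n - (b + 2)) ^ 2.
Proof.
move=> a0 ab n_ge t_ge st obs.
pose r := n - t; pose j := t - (b + 2); set c := b + 2.
have ec : c = b + 2 by [].
have tE : t = c + j by rewrite /j; lia.
have rE : n = c + j + r by rewrite /r; lia.
have c3 : 3 <= c by lia.
have n_ge' : 2 * (a + c) * c <= c + j + r by rewrite -rE; apply: leq_trans n_ge; rewrite ec; nia.
have sr : s <= r by lia.
have -> : n - c = r + j by lia.
rewrite -/r; clearbody r j c.
(* [obs] eliminates [d]; the factor [j + 2] is [t - b]. *)
suff main : 2 * s * (j + 2) + 2 * a * (c + j) < 2 * r * j + j ^ 2 + r + 2.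
  have : r * r.-1 + r = r ^ 2 by case: (r) => [|k] //=; nia.
  by rewrite tE ec in obs *; lia.
rewrite tE in obs.
(* [b * s] is below [a * (c + j)], and [s] is at most [r]; the split tells which bound on [s] is the
   better one. *)
have [br|br] := leqP (a * (c + j)) (b * r).
(* This is [main] times [b], with [b * s] replaced by [a * (c + j) - 1]. *)
- have goal_b : 2 * a * (c + j) ^ 2 < b * (2 * r * j + j ^ 2 + r + 2) + 2 * (j + 2).
    have [jc|jc] := leqP (3 * c) j.
      have h1 : 2 * (c + j) * c <= j ^ 2 by nia.
      have h2 : a * (2 * (c + j) * c) <= b * j ^ 2 by exact: leq_mul.
      have h3 : a * (c + j) * (2 * j) <= b * r * (2 * j) by rewrite leq_mul2r br orbT.
      lia.
    have h1 : 2 * c ^ 2 + c <= r + j by have := leq_pmull c a0; lia.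
    have h2 : 4 * c + j + 1 <= 2 * r by nia.
    have h3 : (4 * c + j + 1) * j <= 2 * r * j by rewrite leq_mul2r h2 orbT.
    have {}h3 : 2 * (c + j) ^ 2 < 2 * r * j + j ^ 2 + r + 2 by lia.
    have h4 : a * (2 * (c + j) ^ 2) <= b * (2 * r * j + j ^ 2 + r + 2).
      by apply: leq_mul => //; exact: ltnW.
    lia.
  rewrite -(@ltn_pmul2l b); last by lia.
  have h : (b * s + 1) * (2 * (j + 2)) <= a * (c + j) * (2 * (j + 2)).
    by rewrite leq_mul2r; apply/orP; right; lia.
  have e : 2 * a * (c + j) ^ 2 = a * (c + j) * (2 * (j + 2)) + b * (2 * a * (c + j)).
    by rewrite ec; ring.
  lia.
(* Now [T] holds more than half of the vertices, so [j] is large and [j ^ 2] absorbs the remaining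
   terms. *)
- have rt : r < c + j.
    rewrite -(@ltn_pmul2l b); last by lia.
    by apply: (leq_trans br); rewrite leq_mul2r ab orbT.
  have j_ge : (a + c) * c < c + j by lia.
  have cc : 3 * c <= c * c by rewrite leq_mul2r c3 orbT.
  have ac : 3 * a <= c * a by rewrite leq_mul2r c3 orbT.
  have h1 : (3 + 2 * a) * c <= 2 * j by lia.
  have h2 : 5 + 2 * a <= j by lia.
  have h3 : (5 + 2 * a) * j <= j ^ 2 by rewrite -mulnn leq_mul2r h2 orbT.
  have h4 : s * (j + 2) <= r * (j + 2) by rewrite leq_mul2r sr orbT.
  lia.
Qed.

(** The right side is the sum of squared degrees over the independent part of F: [b] vertices of
    degree [a] and one of degree [2 * a - 1]. Degrees capped at [2 * a - 2] lose at least
    [a - 1]. *)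
Lemma degree_sqr_sum_bound (I : finType) (A : {set I}) (d : I -> nat) (a b : nat) :
  0 < a -> #|A| = b.+1 -> {in A, forall i, a <= d i <= 2 * a - 2} ->
  \sum_(i in A) d i < a * b.+1 + a ->
  \sum_(i in A) d i ^ 2 + (a - 1) <= b * a ^ 2 + (2 * a - 1) ^ 2.
Proof.
move=> a0 cA dA sum_d.
(* Convexity: the product of [d i - a] and [d i - (2 * a - 2)] is not positive. *)
have : \sum_(i in A) (d i ^ 2 + a * (2 * a - 2)) <= \sum_(i in A) (3 * a - 2) * d i.
  by apply: leq_sum => i /dA; nia.
rewrite big_split /= sum_nat_const cA -big_distrr /= => sqr_le.
have lin : (3 * a - 2) * \sum_(i in A) d i <= (3 * a - 2) * (a * b.+1 + (a - 1)).
  by rewrite leq_mul2l; apply/orP; right; lia.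
move: (\sum_(i in A) d i) (\sum_(i in A) d i ^ 2) sqr_le lin => D Q.
case: a a0 {dA sum_d} => // c _.
have -> : 3 * c.+1 - 2 = 3 * c + 1 by lia.
have -> : 2 * c.+1 - 2 = 2 * c by lia.
have -> : 2 * c.+1 - 1 = 2 * c + 1 by lia.
have -> : c.+1 - 1 = c by lia.
lia.
Qed.

(** The base of the square on the right is [n - (b + 2)] at the least admissible [n], hence a lower
    bound for the radius; [a * (b + 2)] bounds the degree sum over [T]. *)
Lemma gap_bound (a b : nat) : 1 < a -> a <= b ->
  2 * (a * (b + 2)) * (b * a ^ 2 + (2 * a - 1) ^ 2) <
  (a - 1) * ((b + 2) * (2 * a + 2 * b + 3)) ^ 2.
Proof.
case: a => [|[|c]] // _ cb.
have h1 : b * c.+2 ^ 2 + (2 * c.+2 - 1) ^ 2 <= c.+2 ^ 2 * (b + 4) by nia.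
have h2 : (4 * c.+2) ^ 2 <= (2 * c.+2 + 2 * b + 3) ^ 2 by rewrite leq_exp2r //; lia.
have h3 : 2 * c.+2 * (b + 4) < 16 * (c.+1 * (b + 2)) by nia.
apply: (@leq_ltn_trans (2 * (c.+2 * (b + 2)) * (c.+2 ^ 2 * (b + 4)))).
  by rewrite leq_mul2l h1 orbT.
apply: (@leq_trans ((c.+2 - 1) * ((b + 2) ^ 2 * (4 * c.+2) ^ 2))); last first.
  by rewrite leq_mul2l [leqRHS]expnMn leq_mul2l h2 !orbT.
have -> : 2 * (c.+2 * (b + 2)) * (c.+2 ^ 2 * (b + 4)) =
  (c.+2 ^ 2 * (b + 2)) * (2 * c.+2 * (b + 4)) by ring.
have -> : (c.+2 - 1) * ((b + 2) ^ 2 * (4 * c.+2) ^ 2) =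
  (c.+2 ^ 2 * (b + 2)) * (16 * (c.+1 * (b + 2))) by rewrite subn1 /=; ring.
by rewrite ltn_pmul2l // muln_gt0 expn_gt0; lia.
Qed.

(** * Comparison with the extremal graph when [T] has [b + 1] vertices *)

Section ExtremalRadius.
Variable R : realType.

Lemma F_graph_spectral_radius_ge (a b n : nat) : 0 < a -> a + b + 1 <= n ->
  ((n - (b + 2))%:R <= spectral_radius R (F_graph n a b))%R.
Proof.
move=> a0 n_ge.
pose W := [set p : F_graph n a b | if p is inr (inr _) then false else true].
have cW : #|W| = n - (b + 1).
  have := cardsC W; rewrite !card_sum !card_ord.
  suff -> : #|~: W| = b.+1 by lia.
  have -> : ~: W = [set (inr (inr t) : F_graph n a b) | t : 'I_b.+1].
    apply/setP => -[i|[k|t]]; rewrite !inE /=.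
    - by apply/esym/negP => /imsetP[].
    - by apply/esym/negP => /imsetP[].
    - by apply/esym/imsetP; exists t.
  by rewrite card_imset ?card_ord // => t t' [].
have := @clique_spectral_radius R _ W; rewrite cW => clique.
have -> : ((n - (b + 2))%:R = (n - (b + 1))%:R - 1 :> R)%R.
  by rewrite -[X in (_ - X)%R]/(1%:R)%R -natrB; [congr (_%:R)%R|]; lia.
apply: clique; last by lia.
move=> [i|[k|t]] [i'|[k'|t']]; rewrite !inE //= => _ _ ne; rewrite /add_rel /=;
  by rewrite ?orbT //; apply/orP; left; apply: contraNneq ne => ->.
Qed.

(** Places F on the vertices of another graph with a prescribed independent part [T];
    [2 * a + b <= n] leaves room for [S] and [E] outside [T]. *)
Lemma F_graph_copy (V : finType) (T : {set V}) (t0 : V) (a b n : nat) :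
  0 < a -> #|V| = n -> 2 * a + b <= n -> #|T| = b.+1 -> t0 \in T ->
  exists S E : {set V}, exists2 f : V -> F_graph n a b,
    [/\ bijective f, [disjoint S & T], [disjoint E & T], [disjoint S & E] &
        #|S| = a /\ #|E| = a.-1] &
    forall u v, adj (f u) (f v) = extremal_rel S T E t0 u v.
Proof.
move=> a0 cV n_ge cT t0T.
have cC : #|~: T| = n - b.+1 by have := cardsC T; lia.
have [S SC cS] : exists2 S : {set V}, S \subset ~: T & #|S| = a.
  by apply: subset_of_card; lia.
have [E EC cE] : exists2 E : {set V}, E \subset ~: T :\: S & #|E| = a.-1.
  apply: subset_of_card; rewrite cardsD (finset.setIidPr SC); lia.
have ST : [disjoint S & T] by rewrite finset.disjoints_subset.
have ET : [disjoint E & T].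
  by rewrite finset.disjoints_subset; apply: fintype.subset_trans EC (finset.subsetDl _ _).
have SE : [disjoint S & E].
  rewrite disjoint_sym; apply/pred0P => v /=; apply/negP => /andP[vE vS].
  by have /fintype.subsetP/(_ _ vE) := EC; rewrite inE vS.
have [f f_bij fE] := @extremal_rel_iso V S T E t0 n a b cV a0 ST ET SE t0T cS cT cE.
by exists S, E, f.
Qed.

(* The eigenvector varies so little off T that it cannot make up for the deficit
   a - 1 in the sum of squared degrees. *)
Lemma spread_margin (a b D Q : nat) (lam M : R) (MF := b * a ^ 2 + (2 * a - 1) ^ 2) :
  1 < a -> a <= b -> D <= a * (b + 2) -> Q + (a - 1) <= MF ->
  (((b + 2) * (2 * a + 2 * b + 3))%:R <= lam)%R -> (0 < M)%R ->
  exists m : R, [/\ (0 <= m)%R,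
    forall z, (lam * (lam + 1) * (M - z) <= D%:R * M)%R -> (m <= z)%R &
    (M ^+ 2 * Q%:R < m ^+ 2 * MF%:R)%R].
Proof.
move=> a1 ab D_le Q_le lam_ge M0; have gapn := gap_bound a1 ab.
set L := (b + 2) * (2 * a + 2 * b + 3) in lam_ge gapn.
have L0 : 0 < L by rewrite /L muln_gt0; lia.
have lam_gt0 : (0 < lam)%R by apply: lt_le_trans lam_ge; rewrite ltr0n.
pose P : R := (lam * (lam + 1))%R.
have P0 : (0 < P)%R by rewrite mulr_gt0 // addr_gt0.
have L2P : ((L ^ 2)%:R <= P :> R)%R.
  rewrite natrX /P expr2 ler_pM ?ler0n //.
  by apply: le_trans lam_ge _; rewrite lerDl.
have DP : (D%:R <= P)%R.
  apply: le_trans L2P; rewrite ler_nat; apply: (leq_trans D_le).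
  apply: (@leq_trans L); last by rewrite -mulnn leq_pmulr.
  by rewrite /L mulnC leq_mul2l; apply/orP; right; lia.
(* The value of [z] for which the gap inequality is an equality. *)
pose m : R := ((P - D%:R) * M / P)%R.
have mP : (m * P = (P - D%:R) * M)%R by rewrite /m divfK // lt0r_neq0.
exists m; split.
- by apply: divr_ge0; [apply: mulr_ge0; [rewrite subr_ge0|exact: ltW]|exact: ltW].
- by move=> z; rewrite -/P /m ler_pdivrMr // => h; lra.
rewrite ltNge; apply/negP.
rewrite -(ler_pM2r (exprn_gt0 2 P0)).
have -> : (m ^+ 2 * MF%:R * P ^+ 2 = M ^+ 2 * ((P - D%:R) ^+ 2 * MF%:R))%R.
  by rewrite mulrAC -exprMn mP; ring.
rewrite [leRHS](_ : _ = M ^+ 2 * (Q%:R * P ^+ 2))%R; last by ring.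
rewrite ler_pM2l ?exprn_gt0 // => ineq.
have sqrR : (Q%:R + (a - 1)%:R <= MF%:R :> R)%R by rewrite -natrD ler_nat.
(* Since the square of [P - D] is at least [P ^ 2 - 2 * D * P], the deficit [a - 1] in [Q] must be
   paid for by the linear term. *)
have ineq2 : ((a - 1)%:R * P <= 2 * D%:R * MF%:R)%R.
  rewrite -(ler_pM2r P0).
  have := ler_wpM2r (sqr_ge0 P) sqrR.
  have : (0 <= D%:R ^+ 2 * MF%:R :> R)%R by rewrite mulr_ge0 ?sqr_ge0.
  lra.
have : ((a - 1)%:R * (L ^ 2)%:R <= (2 * D * MF)%:R :> R)%R.
  rewrite [leRHS](_ : _ = 2 * D%:R * MF%:R)%R; last by rewrite !natrM.
  by apply: le_trans ineq2; apply: ler_wpM2l => //; exact: ler0n.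
rewrite -natrM ler_nat leqNgt => /negP; apply; apply: leq_ltn_trans gapn.
by rewrite leq_mul2r leq_mul2l D_le !orbT.
Qed.

(** * Excess degree spread over several vertices of [T] *)

Section Spread.
Variables (G : sgraph) (T : {set G}).

Lemma clique_closure_adj (u v : G) :
  @adj (add_edges (fun x y : G => (x \notin T) && (y \notin T))) u v =
  adj u v || [&& u != v, u \notin T & v \notin T].
Proof. by rewrite /= /add_rel /= [(v \notin T) && _]andbC orbb. Qed.

Lemma spectral_radius_spread (a b n : nat) : 1 < a -> a <= b -> #|G| = n ->
  2 * (b + a + 2) * (b + 2) <= n -> #|T| = b.+1 ->
  {in T, forall t, a <= degree t <= 2 * a - 2} ->
  \sum_(t in T) degree t < a * b.+1 + a ->
  (spectral_radius R G < spectral_radius R (F_graph n a b))%R.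
Proof.
move=> a1 ab cG n_ge cT degT sum_deg; rewrite ltNge; apply/negP => leFG.
have a0 : 0 < a by exact: ltnW.
have twoa : 2 * a - 1 = a + a.-1 by lia.
(* Completing the clique off [T] keeps the degrees in [T] and can only raise the radius. *)
pose G' := add_edges (fun x y : G => (x \notin T) && (y \notin T)).
have deg' t : t \in T -> @degree G' t = degree t.
  move=> tT; apply: eq_card => u; rewrite !inE clique_closure_adj.
  by rewrite tT /= andbF orbF.
have leGG' : (spectral_radius R G <= spectral_radius R G')%R.
  apply: (@spectral_radius_hom R G G' id); first by exists id.
  by move=> u v uv; rewrite clique_closure_adj uv.
set lam := spectral_radius R G' in leGG'.
have L_ge : (b + 2) * (2 * a + 2 * b + 3) <= n - (b + 2) by nia.
have n_ge2 : 2 * a + b + 1 <= n by nia.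
have lam_ge : (((b + 2) * (2 * a + 2 * b + 3))%:R <= lam)%R.
  apply: le_trans (le_trans leFG leGG').
  apply: le_trans (F_graph_spectral_radius_ge _ _) => //; last by lia.
  by rewrite ler_nat.
have lam_gt0 : (0 < lam)%R by apply: lt_le_trans lam_ge; rewrite ltr0n; nia.
have [t0 t0T] : exists t0, t0 \in T by apply/card_gt0P; rewrite cT.
have clique (u v : G') : u \notin T -> v \notin T -> u != v -> adj u v.
  by move=> uT vT uv; rewrite clique_closure_adj uT vT uv orbT.
have [x [x_ge0 x_pos eig]] := @spectral_radius_eigenvector R G' t0.
have [|M [M0 xM gap]] := clique_eigenvector_gap clique x_ge0 lam_gt0 eig x_pos.
  move=> t tT; rewrite (deg' t tT).
  apply: lt_le_trans lam_ge; rewrite ltr_nat.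
  by have /andP[_] := degT t tT; have := leq_pmull (2 * a + 2 * b + 3) (ltn0Sn (b + 1)); lia.
have [S [E [f [f_bij ST ET SE [cS cE]] fE]]] :=
  @F_graph_copy G' T t0 a b n a0 cG ltac:(lia) cT t0T.
have notT (A : {set G}) : [disjoint A & T] -> forall v, v \in A -> v \notin T.
  by move=> AT v vA; rewrite (disjointFr AT vA).
have inF (A : {set G}) w : [disjoint A & T] -> w \in T -> w \in A = false.
  by move=> AT; exact: disjointFl.
have e_clique u v : u \notin T -> v \notin T -> extremal_rel S T E t0 u v = (u != v).
  by move=> uT vT; rewrite /extremal_rel /extremal_half uT vT /= andbT.
have e_indep u v : u \in T -> v \in T -> extremal_rel S T E t0 u v = false.
  by move=> uT vT; rewrite /extremal_rel /extremal_half uT vT !(inF S) // !(inF E) // !andbF.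
have mid := clique_compare clique x_ge0 lam_gt0 eig f_bij fE e_clique e_indep (le_trans leFG leGG').
pose D := \sum_(t in T) degree t.
have Deq : \sum_(t in T) @degree G' t = D by apply: eq_bigr => t; exact: deg'.
rewrite Deq in gap.
have D_le : D <= a * (b + 2).
  by rewrite (_ : a * (b + 2) = a * b.+1 + a) ?(ltnW sum_deg) //; ring.
have sqr := degree_sqr_sum_bound a0 cT degT sum_deg.
have [m [m0 m_le margin]] := spread_margin a1 ab D_le sqr lam_ge M0.
have xm w : w \notin T -> (m <= x w)%R by move=> /gap/m_le.
pose MF := b * a ^ 2 + (2 * a - 1) ^ 2.
(* In the copy of F, [t0] has [2 * a - 1] neighbours off [T] and the other vertices of [T] have [a],
   all with entries at least [m]. *)
have low : (m ^+ 2 * MF%:R <= \sum_(t in T)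
    (\sum_(v | (v \notin T) && extremal_rel S T E t0 t v) x v) ^+ 2)%R.
  have card_low t (A : {set G}) : (forall v, v \in A -> (v \notin T) && extremal_rel S T E t0 t v) ->
      ((m * #|A|%:R) ^+ 2 <= (\sum_(v | (v \notin T) && extremal_rel S T E t0 t v) x v) ^+ 2)%R.
    move=> sub; rewrite ler_sqr ?nnegrE ?mulr_ge0 ?ler0n //; last by apply: sumr_ge0.
    rewrite mulr_natr -sumr_const big_mkcond [leRHS]big_mkcond /=.
    apply: ler_sum => v _; case: ifP => [vA|_].
      by rewrite sub // xm //; have /andP[] := sub v vA.
    by case: ifP.
  rewrite (bigD1 t0) //=.
  have -> : (m ^+ 2 * MF%:R = (m * (2 * a - 1)%:R) ^+ 2 + \sum_(t in T | t != t0) (m * a%:R) ^+ 2)%R.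
    rewrite sumr_const (_ : #|_| = b); last first.
      have := cardsD1 t0 T; rewrite t0T cT => -[->].
      by apply: eq_card => v; rewrite !inE andbC.
    by rewrite /MF natrD natrM !natrX -mulr_natr; ring.
  have SU v : v \in S -> v \notin T by exact: notT.
  have EU v : v \in E -> v \notin T by exact: notT.
  have neT t v : t \in T -> v \notin T -> t != v by move=> tT; apply: contraNneq => <-.
  apply: lerD.
    have -> : 2 * a - 1 = #|S :|: E|.
      by rewrite twoa cardsU (disjoint_setI0 SE) cards0 subn0 cS cE.
    apply: card_low => v vSE.
    have vT : v \notin T by move: vSE; rewrite inE => /orP[/SU|/EU].
    rewrite vT /extremal_rel neT //= /extremal_half t0T eqxx /=.
    by move: vSE; rewrite inE => ->.
  apply: ler_sum => t /andP[tT _]; rewrite -cS; apply: card_low => v vS.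
  by rewrite SU // /extremal_rel neT ?SU //= /extremal_half tT vS orbT.
have up : (\sum_(t in T) (lam * x t) ^+ 2 <= M ^+ 2 * (\sum_(t in T) degree t ^ 2)%:R)%R.
  rewrite natr_sum mulr_sumr; apply: ler_sum => t tT.
  have le_t : (lam * x t <= (degree t)%:R * M)%R.
    by rewrite -(deg' t tT); apply: (neighbour_sum_le eig).
  have t_ge0 : (0 <= lam * x t)%R by apply: mulr_ge0; [exact: ltW|exact: x_ge0].
  by rewrite natrX [leRHS]mulrC -exprMn ler_sqr ?nnegrE // (le_trans t_ge0).
by have := le_lt_trans (le_trans low (le_trans mid up)) margin; rewrite ltxx.
Qed.

End Spread.
(** The vertex [t0] uses up all the slack: counting forces [#|S| = a], exactly [a - 1] neighbours of
    [t0] outside [S], and none for the rest of [T]. So [G] embeds in F as a spanning subgraph. *)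
Lemma F_graph_tight (G : sgraph) (S T : {set G}) (a b n : nat) :
  0 < a -> connected_graph G -> #|G| = n ->
  [disjoint S & T] -> #|T| = b.+1 -> #|S| <= a ->
  b * #|S| + \sum_(v in T) #|[set u | adj v u & u \notin S]| < a * b.+1 ->
  {in T, forall t, a <= degree t} -> (exists2 t0, t0 \in T & 2 * a - 1 <= degree t0) ->
  (spectral_radius R (F_graph n a b) <= spectral_radius R G)%R ->
  isomorphic G (F_graph n a b).
Proof.
move=> a0 conn cG ST cT Sa obs degT [t0 t0T deg_t0] leFG.
pose d v := #|[set u | adj v u & u \notin S]|.
have cT0 : #|T :\ t0| = b by have := cardsD1 t0 T; rewrite t0T cT => -[].
have sum_d : \sum_(v in T) d v = d t0 + \sum_(v in T :\ t0) d v.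
  by rewrite (big_setD1 t0).
have d_ge v : v \in T -> a - #|S| <= d v.
  by move=> vT; rewrite leq_subLR (leq_trans (degT v vT)) ?degree_le.
have d_t0 : 2 * a - 1 - #|S| <= d t0.
  by rewrite leq_subLR (leq_trans deg_t0) ?degree_le.
have sum_ge : b * (a - #|S|) <= \sum_(v in T :\ t0) d v.
  by rewrite -cT0 -sum_nat_const; apply: leq_sum => v /setD1P[_ /d_ge].
rewrite -/d sum_d in obs.
(* Adding the lower bounds for [t0] and for the rest of [T] to [obs] leaves [a - 1 < #|S|]. *)
have cS : #|S| = a by move: obs sum_ge d_t0 Sa a0; clear; nia.
rewrite cS in obs d_t0.
have [dt0 dT] : d t0 = a.-1 /\ \sum_(v in T :\ t0) d v = 0.
  by move: obs d_t0; clear -a0; lia.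
have nbrS v : v \in T -> v != t0 -> forall u, adj v u -> u \in S.
  move=> vT vt0 u vu; apply/negPn/negP => uS.
  have : d v = 0.
    by apply/eqP; move/eqP: dT; rewrite sum_nat_eq0 => /forall_inP/(_ v); rewrite !inE vt0 vT => ->.
  by move/eqP; rewrite cards_eq0 => /eqP/setP/(_ u); rewrite !inE vu uS.
pose E := [set u | adj t0 u & u \notin S].
have SE : [disjoint S & E].
  by apply/pred0P => u /=; rewrite !inE; case: (u \in S); rewrite ?andbF.
(* A neighbour of [t0] in [T] has all its neighbours in [S], whereas [t0] is not in [S]. *)
have ET : [disjoint E & T].
  apply/pred0P => u /=; apply/negP; rewrite !inE => /andP[/andP[t0u uS] uT].
  have ut0 : u != t0 by rewrite eq_sym adj_neq.
  have := nbrS u uT ut0 t0; rewrite adj_sym t0u => /(_ isT) t0S.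
  by rewrite (disjointFr ST t0S) in t0T.
have [f f_bij fE] := extremal_rel_iso cG a0 ST ET SE t0T cS cT dt0.
apply: spectral_radius_strict f_bij _ conn leFG => u v uv.
have half x y : x \in T -> adj x y -> extremal_half S T E t0 x y.
  move=> xT xy; rewrite /extremal_half xT /=.
  have [xt0|xt0] := eqVneq x t0; last by rewrite (nbrS x).
  by rewrite inE -xt0 xy; case: (y \in S).
rewrite fE /extremal_rel adj_neq //=.
have [uT|uT] := boolP (u \in T); first by rewrite half.
have [vT|vT] := boolP (v \in T); first by rewrite [X in _ || X]half ?orbT // adj_sym.
by rewrite /extremal_half uT vT.
Qed.

End ExtremalRadius.

(** * Case analysis on the obstructing pair *)

Theorem theorem5p3 (R : realType) (a b n : nat) (G : sgraph) :
  1 <= a -> a <= b ->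
  #|G| = n -> 2 * (b + a + 2) * (b + 2) <= n ->
  connected_graph G ->
  a <= min_degree G ->
  (spectral_radius R (F_graph n a b) <= spectral_radius R G)%R ->
  ~ isomorphic G (F_graph n a b) ->
  fractional_factor R a b G.
Proof.
move=> a0 ab cG n_ge conn amin leFG not_iso; apply: contrapT => no_factor.
have [S [T [ST obs]]] := fractional_factor_obstruction ab no_factor.
have bT := obstruction_card a0 ab amin obs.
have n_ge2 : 2 * a + b + 1 <= n by move: n_ge; clear; nia.
have STn : #|S| + #|T| <= n.
  by rewrite -cG -cardsUI (disjoint_setI0 ST) cards0 addn0 max_card.
have degT (t : G) : a <= degree t by exact: leq_trans amin (min_degree_le t).
have sum_deg : \sum_(t in T) degree t <=
    #|S| * #|T| + \sum_(t in T) #|[set u | adj t u & u \notin S]|.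
  by rewrite mulnC -sum_nat_const -big_split; apply: leq_sum => t _; exact: degree_le.
have [bT2|Tb] := leqP (b + 2) #|T|.
  have sum_lt : \sum_(v : G) degree v < (n - (b + 2)) ^ 2.
    apply: leq_ltn_trans (edge_count_bound a0 ab n_ge bT2 STn obs).
    by apply: leq_trans (sum_degree_le T) _; rewrite cG leq_add2l leq_mul2l.
  have := le_lt_trans (spectral_radius_sqr_le R G) (_ : _ < ((n - (b + 2)) ^ 2)%:R)%R.
  rewrite ltr_nat => /(_ sum_lt); rewrite natrX ltNge => /negP; apply.
  rewrite ler_sqr ?nnegrE ?ler0n ?spectral_radius_ge0 //.
  apply: le_trans leFG; apply: F_graph_spectral_radius_ge => //.
  by move: n_ge2; clear; lia.
have cT : #|T| = b.+1 by move: bT Tb; clear; lia.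
rewrite cT in obs sum_deg.
(* With [#|S| > a], [b * #|S|] would be at least [a * b + b], hence at least [a * b.+1]. *)
have Sa : #|S| <= a by move: obs ab; clear; nia.
have [t0 /andP[t0T deg_t0]|spread] := pickP (fun t => (t \in T) && (2 * a - 1 <= degree t)).
  apply: not_iso; apply: (F_graph_tight a0 conn cG ST cT Sa obs _ _ leFG) => //.
  by exists t0.
(* For [a = 1] the threshold [2 * a - 1] is the minimum degree bound itself, so the previous case
   applies to any vertex of [T]. *)
have a1 : 1 < a.
  have [t tT] : exists t, t \in T by apply/card_gt0P; rewrite cT.
  have := spread t; rewrite tT => /negbT; have := degT t; move: a0; clear; lia.
have small_deg : {in T, forall t, a <= degree t <= 2 * a - 2}.
  move=> t tT; rewrite degT /=; have := spread t; rewrite tT => /negbT.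
  by move: a1; clear; lia.
(* The degree sum exceeds the left side of [obs] by at most [#|S|], itself at most [a]. *)
have small_sum : \sum_(t in T) degree t < a * b.+1 + a.
  by move: sum_deg obs Sa; clear; lia.
have := spectral_radius_spread R a1 ab cG n_ge cT small_deg small_sum.
by rewrite ltNge leFG.
Qed.
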